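(* The set $U(T,E)$ of universal generalized harmonic functions is a dense $G_\delta$ subset of $H(T,E)$ (with respect to the topology of $H(T,E)$ described in the context).
   Context: Tree. $T=\bigcup_{n=0}^\infty T_n$ is the vertex set of a rooted tree; $T_n$ is the (finite) set of vertices at level $n$, the $T_n$ are pairwise disjoint, $T_0=\{x_0\}$. Every $x\in T_n$ has a set of children $S(x)\subset T_{n+1}$ with at least two elements, and $(S(x))_{x\in T_n}$ is a partition of $T_{n+1}$. Field and vector space. $\mathbb{F}$ is a field with a separable Hausdorff topology for which addition and the inverse function are continuous. $E$ is a separable topological vector space over $\mathbb{F}$ whose topology is induced by a translation invariant metric $d$; $(E,d)$ is not assumed complete. Generalized harmonic functions. For every $x\in T$ and $y\in S(x)$ an element $w(x,y)\in\mathbb{F}\setminus\{0\}$ is fixed. $H(T,E)$ is the set of functions $f:T\to E$ with $f(x)=\sum_{y\in S(x)}w(x,y)f(y)$ for all $x\in T$. It carries the subspace topology from $E^T$ with the product topology (induced by the metric $\rho(f,g)=\sum_{n=0}^\infty 2^{-n}\frac{d(f(x_n),g(x_n))}{1+d(f(x_n),g(x_n))}$, where $(x_n)_{n\ge 0}$ is a fixed enumeration of $T$). Boundary and measure. Real weights $q(x,y)\ge 0$ ($x,y\in T$) are given with $q(x,y)>0$ if and only if $y\in S(x)$, and $\sum_{y\in S(x)}q(x,y)=1$ for all $x$. The boundary $\partial T$ is the set of all infinite geodesics $e=\{z_n:n\ge 0\}$ with $z_0=x_0$ and $z_{n+1}\in S(z_n)$. For $x\in T$, $B_x=\{e\in\partial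 T: x\in e\}$. $M_n$ is the $\sigma$-algebra on $\partial T$ generated by $\{B_x\}_{x\in T_n}$, and $M$ is the $\sigma$-algebra generated by $\bigcup_n M_n$. $\mathbb{P}$ is the unique probability measure on $M$ such that for $x\in T_n$, $\mathbb{P}(B_x)=\prod_{j=0}^{n-1}q(y_j,y_{j+1})$, where $x_0=y_0,y_1,\dots,y_n=x$ is the unique path from the root to $x$. $L^0(\partial T,E)$ is the space of $M$-measurable functions $h:\partial T\to E$ (that is, $h^{-1}(V)\in M$ for every open $V\subset E$), modulo $\mathbb{P}$-a.e. equality, with the topology of convergence in probability, given by the metric $d_{\mathbb{P}}(h,g)=\int_{\partial T}\frac{d(h(e),g(e))}{1+d(h(e),g(e))}\,d\mathbb{P}(e)$. For $f:T\to E$ and $n\ge 0$, $\omega_n(f):\partial T\to E$ is defined by $\omega_n(f)(e)=f(z)$, where $z$ is the unique element of $e\cap T_n$. Universality. $f\in H(T,E)$ is universal, written $f\in U(T,E)$, if the sequence $\omega_n(f)$, $n=0,1,2,\dots$, is dense in $L^0(\partial T,E)$. *)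

(* Defs.v *)
From HB Require Import structures.
From mathcomp Require Import all_boot all_order all_algebra.
From mathcomp Require Import all_classical all_reals all_analysis.
From mathcomp Require Import measurable_realfun lra.

Set Implicit Arguments.
Unset Strict Implicit.
Unset Printing Implicit Defensive.
Import Order.TTheory GRing.Theory Num.Theory.
Import numFieldNormedType.Exports.

Local Open Scope classical_set_scope.
Local Open Scope ring_scope.

Definition separable (X : topologicalType) :=
  exists2 D : set X, countable D & dense D.

(* Multiplicative inversion is only required to be continuous away from 0, where
   x^-1 is not a junk value; continuity of multiplication is not assumed. *)
HB.mixin Record isSepTopField (F : Type) & GRing.Field F & Topological F := {
  topfield_hausdorff : hausdorff_space F ;
  topfield_separable : separable F ;
  topfield_add_continuous : continuous (fun z : F * F => z.1 + z.2) ;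
  topfield_inv_continuous :
    forall x : F, x != 0 -> {for x, continuous (@GRing.inv F)}
}.

#[short(type="sepTopFieldType")]
HB.structure Definition SepTopField :=
  {F of GRing.Field F & Topological F & isSepTopField F}.

(* A vector space over F equipped with a distance. The library's hierarchies of
   topological modules are restricted to scalars in a numDomainType, hence this
   packaging: the type [points V] carries both the F-module structure and the
   Metric structure (so the topology induced by the distance). *)
Record metricLmod (R : realType) (F : sepTopFieldType) := MetricLmod {
  vspace_of : lmodType F ;
  dist_of : vspace_of -> vspace_of -> R ;
  dist_of_xx : forall x, dist_of x x = 0 ;
  dist_of_eq0 : forall x y, dist_of x y = 0 -> x = y ;
  dist_of_sym : forall x y, dist_of x y = dist_of y x ;
  dist_of_triangle : forall y x z, dist_of x z <= dist_of x y + dist_of y z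
}.

Definition points (R : realType) (F : sepTopFieldType) (V : metricLmod R F) :
  Type := vspace_of V.
Coercion points : metricLmod >-> Sortclass.

HB.instance Definition _ R F (V : metricLmod R F) := GRing.Lmodule.on (points V).
HB.instance Definition _ R F (V : metricLmod R F) :=
  isMetric.Build R (points V) (@dist_of_xx R F V) (@dist_of_eq0 R F V)
    (@dist_of_sym R F V) (@dist_of_triangle R F V).

Record sepMetricTvs (R : realType) (F : sepTopFieldType) := SepMetricTvs {
  tvs_metricLmod :> metricLmod R F ;
  tvs_add_continuous :
    continuous (fun z : tvs_metricLmod * tvs_metricLmod => z.1 + z.2) ;
  tvs_scale_continuous :
    continuous (fun z : F * tvs_metricLmod => z.1 *: z.2) ;
  tvs_separable : separable tvs_metricLmod ;
  tvs_translation : forall a x y : tvs_metricLmod,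
    mdist (x + a) (y + a) = mdist x y
}.

Section borel.
Context {R : realType} {F : sepTopFieldType} (E : sepMetricTvs R F).

Definition borel : Type := E.

HB.instance Definition _ := Metric.on borel.
HB.instance Definition _ := isPointed.Build borel (0 : E).
HB.instance Definition _ := @isMeasurable.Build (sigma_display (@open E)) borel
  <<s @open E >> (@sigma_algebra0 _ setT (@open E))
  (@sigma_algebraC borel (@open E)) (@sigma_algebra_bigcup _ setT (@open E)).

Lemma borel_measurable_funP d (X : measurableType d) (h : X -> borel) :
  measurable_fun setT h <-> forall V : set E, open V -> measurable (h @^-1` V).
Proof.
split=> [mh V oV|mh].
  by rewrite -[_ @^-1` _]setTI; apply: mh => //; exact: sub_sigma_algebra.
apply: (@measurability _ _ _ _ setT h (@open E)) => //.
by move=> _ [V oV <-]; rewrite setTI; exact: mh.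
Qed.

End borel.

Section bounded_distance.
Context {R : realType} {F : sepTopFieldType} {E : sepMetricTvs R F}.
Implicit Types x y z : E.

Definition bdist x y : R := mdist x y / (1 + mdist x y).

Let ratio_mono (a b : R) : 0 <= a -> a <= b -> a / (1 + a) <= b / (1 + b).
Proof.
move=> a0 ab; have b0 := le_trans a0 ab.
rewrite ler_pdivrMr ?ltr_pwDl// mulrAC ler_pdivlMr ?ltr_pwDl//.
by rewrite !mulrDr !mulr1 (mulrC b a) lerD2r.
Qed.

Lemma bdist_ge0 x y : 0 <= bdist x y.
Proof. by rewrite divr_ge0 ?addr_ge0 ?mdist_ge0. Qed.

Lemma bdist_le1 x y : bdist x y <= 1.
Proof.
by rewrite ler_pdivrMr ?mul1r ?ltr_pwDl ?mdist_ge0// lerDr.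
Qed.

Lemma bdistxx x : bdist x x = 0.
Proof. by rewrite /bdist mdistxx mul0r. Qed.

Lemma bdist_eq0 x y : bdist x y = 0 -> x = y.
Proof.
have d0 : 1 + mdist x y != 0 by rewrite gt_eqF// ltr_pwDl ?mdist_ge0.
by move/eqP; rewrite mulf_eq0 invr_eq0 (negbTE d0) orbF => /eqP/mdist_positivity.
Qed.

Lemma bdist_sym x y : bdist x y = bdist y x.
Proof. by rewrite /bdist metric_sym. Qed.

Lemma bdist_triangle y x z : bdist x z <= bdist x y + bdist y z.
Proof.
apply: le_trans (ratio_mono (mdist_ge0 x z) (metric_triangle x y z)) _.
rewrite /bdist mulrDl; have [? ?] := (mdist_ge0 x y, mdist_ge0 y z).
apply: lerD; apply: ler_wpM2l => //;
  rewrite lef_pV2 ?posrE ?ltr_pwDl ?addr_ge0//.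
  by rewrite lerD2l lerDl.
by rewrite lerD2l lerDr.
Qed.

Lemma open_mball x (r : R) : open [set y : E | mdist x y < r].
Proof.
rewrite openE => y /= yr; rewrite /interior/=.
apply/nbhs_ballP; exists (r - mdist x y); first by rewrite /= subr_gt0.
move=> z; rewrite ballEmdist/= => yz.
by rewrite (le_lt_trans (metric_triangle _ y _))// addrC -ltrBrDr.
Qed.

Lemma measurable_mdist d (X : measurableType d) (h g : {mfun X >-> borel E}) :
  measurable_fun setT (fun e => mdist (h e : E) (g e : E)).
Proof.
have mball (u : {mfun X >-> borel E}) (a : E) (r : R) :
    measurable [set e | mdist a (u e : E) < r].
  have /borel_measurable_funP mu := measurable_funPT u.
  exact: (mu _ (@open_mball a r)).
have [D cD dD] := tvs_separable E.
apply: (@measurability _ _ _ _ setT _ _ (RGenInftyO.measurableE R)) => //.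
move=> _ [_ [r ->] <-]; rewrite setTI.
rewrite (_ : _ @^-1` _ = \bigcup_(a in D) \bigcup_(s : rat)
  ([set e | mdist a (h e : E) < ratr s] `&`
   [set e | mdist a (g e : E) < r - ratr s])).
  have [->|[f]] := pfcard_geP cD; first by rewrite bigcup_set0.
  rewrite -(image_eq f) bigcup_image; apply: bigcup_measurable => n _.
  by apply: bigcupT_measurable_rat => s; exact: measurableI.
apply/seteqP; split => e /=; rewrite in_itv/=.
  move=> hgr; set t := (r - mdist (h e : E) (g e : E)) / 2.
  have t0 : 0 < t by rewrite divr_gt0// subr_gt0.
  have [a [/= hat Da]] : [set y : E | mdist (h e : E) y < t] `&` D !=set0.
    by apply: dD; [exists (h e); rewrite /= mdistxx|exact: open_mball].
  have /rat_in_itvoo[s] : mdist a (h e : E) < r - mdist a (g e : E).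
    have := metric_triangle a (h e : E) (g e : E).
    by move: hat hgr; rewrite /t (metric_sym (h e : E) a); lra.
  rewrite in_itv/= => /andP[has sga].
  by exists a => //; exists s => //; split => //=; rewrite ltrBrDl -ltrBrDr.
move=> [a Da [s _ [/= has gas]]].
rewrite (le_lt_trans (metric_triangle _ a _))// metric_sym.
by rewrite -(subrK (ratr s) r) [ltRHS]addrC ltrD.
Qed.

Lemma measurable_bdist d (X : measurableType d) (h g : {mfun X >-> borel E}) :
  measurable_fun setT (fun e => bdist (h e : E) (g e : E)).
Proof.
pose f (t : R) := `|t| / (1 + `|t|).
have cf : continuous f.
  move=> t; apply: cvgM; first exact: norm_continuous.
  apply: cvgV; first by rewrite gt_eqF// ltr_pwDl.
  by apply: cvgD; [exact: cvg_cst|exact: norm_continuous].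
rewrite (_ : (fun _ => _) = f \o (fun e => mdist (h e : E) (g e : E))).
  apply: measurableT_comp; last exact: measurable_mdist.
  exact: continuous_measurable_fun.
by apply/funext => e /=; rewrite /f ger0_norm ?mdist_ge0.
Qed.

End bounded_distance.

Section L0.
Context {d : measure_display} {X : measurableType d} {R : realType}
        {F : sepTopFieldType} (P : probability X R) (E : sepMetricTvs R F).

Definition L0 : Type := {mfun_ P, X >-> borel E}.

HB.instance Definition _ := Choice.on L0.
HB.instance Definition _ := EqQuotient.on L0.

Definition L0_class (h : {mfun X >-> borel E}) : L0 := \pi%qT h.

Definition prob_dist (h g : X -> E) : R := \int[P]_x bdist (h x) (g x).

Definition L0_dist (h g : L0) : R :=
  prob_dist (repr h : {mfun X >-> borel E}) (repr g : {mfun X >-> borel E}).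

Let integrable_bdist (h g : {mfun X >-> borel E}) :
  P.-integrable setT (EFin \o (fun x => bdist (h x : E) (g x : E))).
Proof.
apply: measurable_bounded_integrable => //.
- exact: le_lt_trans (probability_le1 P measurableT) (ltry _).
- exact: measurable_bdist.
- exists 1; split => // M M1 x _ /=.
  by rewrite ger0_norm ?bdist_ge0// (le_trans (bdist_le1 _ _))// ltW.
Qed.

Lemma prob_dist_ae_eq (h h' g g' : {mfun X >-> borel E}) :
  h = h' %[ae P] -> g = g' %[ae P] -> prob_dist h g = prob_dist h' g'.
Proof.
move=> hh' gg'; congr (fine _); apply: ae_eq_integral => //.
- exact/measurable_EFinP/measurable_bdist.
- exact/measurable_EFinP/measurable_bdist.
- by move: hh' gg'; apply: filterS2 => x hx gx _ /=; rewrite hx// gx.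
Qed.

Lemma L0_dist_class (h g : {mfun X >-> borel E}) :
  L0_dist (L0_class h) (L0_class g) = prob_dist h g.
Proof.
have reprP (k : {mfun X >-> borel E}) :
    (repr (L0_class k) : {mfun X >-> borel E}) = k %[ae P].
  have /eqP := reprK (L0_class k); rewrite eqmodE; exact: asboolW.
exact: prob_dist_ae_eq.
Qed.

Let L0_distxx h : L0_dist h h = 0.
Proof.
rewrite /L0_dist /prob_dist /Rintegral.
by under eq_integral do rewrite bdistxx; rewrite integral0.
Qed.

Let L0_dist_eq0 h g : L0_dist h g = 0 -> h = g.
Proof.
rewrite /L0_dist; move=> hg0; apply/eqP.
rewrite -[h]reprK -[g]reprK eqmodE; apply/asboolP; move: hg0.
move: (repr h : {mfun X >-> borel E}) (repr g : {mfun X >-> borel E}).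
rewrite /prob_dist => {}h {}g hg0.
pose k := EFin \o (fun x => bdist (h x : E) (g x : E)).
have mk : measurable_fun setT k by exact/measurable_EFinP/measurable_bdist.
have : (\int[P]_x `|k x| = 0)%E.
  under eq_integral do rewrite /k /= ger0_norm ?bdist_ge0//.
  have kfin : (\int[P]_x k x)%E \is a fin_num.
    exact/integrable_fin_num/integrable_bdist.
  by rewrite -(fineK kfin) [fine _]hg0.
move=> /(ae_eq_integral_abs _ measurableT mk); apply: filterS => x /= kx _.
by have [/bdist_eq0] := kx I.
Qed.

Let L0_dist_sym h g : L0_dist h g = L0_dist g h.
Proof. by apply: eq_Rintegral => x _; exact: bdist_sym. Qed.

Let L0_dist_triangle g h k : L0_dist h k <= L0_dist h g + L0_dist g k.
Proof.
rewrite /L0_dist.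
move: (repr h : {mfun X >-> borel E}) (repr g : {mfun X >-> borel E})
  (repr k : {mfun X >-> borel E}) => {}h {}g {}k.
have [ihk ihg igk] := And3 (integrable_bdist h k) (integrable_bdist h g)
  (integrable_bdist g k).
rewrite /prob_dist -RintegralD//.
apply: le_Rintegral => //; first exact: (integrableD measurableT ihg igk).
by move=> x _; exact: bdist_triangle.
Qed.

HB.instance Definition _ := isMetric.Build R L0
  L0_distxx L0_dist_eq0 L0_dist_sym L0_dist_triangle.

End L0.

Record rooted_tree := RootedTree {
  vertex :> choiceType ;
  level : nat -> set vertex ;
  tree_root : vertex ;
  child : vertex -> set vertex ;
  level_cover : \bigcup_n level n = setT ;
  level_disjoint : trivIset setT level ;
  level_finite : forall n, finite_set (level n) ;
  level0 : level 0%N = [set tree_root] ;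
  child_ge2 : forall x, exists y z, [/\ child x y, child x z & y <> z] ;
  child_partition : forall n, partition (level n) child (level n.+1)
}.
Arguments tree_root {r}.

Section boundary.
Context (T : rooted_tree).

(* An infinite geodesic {z_n : n >= 0} is represented by the sequence (z_n),
   which it determines because z_n is its only vertex at level n. *)
Definition geodesics : set (nat -> T) :=
  [set z | z 0%N = tree_root /\ forall n, child (z n) (z n.+1)].

Definition boundary : Type := set_type geodesics.

Definition geodesic (e : boundary) : nat -> T := set_val e.

Lemma geodesic_level (e : boundary) n : level n (geodesic e n).
Proof.
have [e0 eS] : geodesics (geodesic e) := set_valP e.
elim: n => [|n IHn]; first by rewrite level0 e0.
by have [<- _ _] := child_partition T n; exists (geodesic e n).
Qed.

Lemma boundary_nonempty : exists e : boundary, True.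
Proof.
have /boolp.choice[f cf] : forall x : T, exists y, child x y.
  by move=> x; have [y [_ [xy _ _]]] := child_ge2 x; exists y.
have gf : geodesics (fun n => iter n f tree_root) by split => // n; exact: cf.
by exists (SigSub (mem_set gf)).
Qed.

HB.instance Definition _ := Choice.on boundary.
HB.instance Definition _ := isPointed.Build boundary
  (projT1 (cid boundary_nonempty)).

Definition cylinder (x : T) : set boundary :=
  [set e | exists n, geodesic e n = x].

Definition level_algebra (n : nat) : set (set boundary) :=
  <<s [set cylinder x | x in level n] >>.

Definition boundary_gen : set (set boundary) := \bigcup_n level_algebra n.

HB.instance Definition _ := @isMeasurable.Build (sigma_display boundary_gen)
  boundary <<s boundary_gen >> (@sigma_algebra0 _ setT boundary_gen)
  (@sigma_algebraC boundary boundary_gen)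
  (@sigma_algebra_bigcup _ setT boundary_gen).

Lemma measurable_cylinder x : measurable (cylinder x : set boundary).
Proof.
have [n _ nx] : (\bigcup_n level n) x by rewrite level_cover.
apply: sub_sigma_algebra; exists n => //.
by apply: sub_sigma_algebra; exists x.
Qed.

Lemma cylinderE n x : level n x -> cylinder x = [set e | geodesic e n = x].
Proof.
move=> nx; apply/seteqP; split => e /= => [[m mx]|]; last by exists n.
rewrite -[in LHS](_ : m = n)//; apply: (@level_disjoint T) => //.
by exists x; split => //; rewrite -mx; exact: geodesic_level.
Qed.

End boundary.

Section harmonic_functions.
Context {R : realType} {F : sepTopFieldType} {E : sepMetricTvs R F}
        {T : rooted_tree}.

Definition harmonic_functions (w : T -> T -> F) : set {ptws T -> E} :=
  [set f | forall x, f x = \sum_(y \in child x) w x y *: f y].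

Definition omega (n : nat) (f : T -> E) : boundary T -> borel E :=
  fun e => f (geodesic e n).

Lemma measurable_omega n f : measurable_fun setT (omega n f).
Proof.
apply/borel_measurable_funP => V _.
rewrite (_ : _ @^-1` _ = \bigcup_(x in level n `&` f @^-1` V) cylinder x).
  apply: fin_bigcup_measurable => [|x _]; last exact: measurable_cylinder.
  exact/finite_setIl/level_finite.
apply/seteqP; split => e /=.
  move=> fV; exists (geodesic e n); last by exists n.
  by split => //; exact: geodesic_level.
by move=> [x [nx fx]]; rewrite (cylinderE nx) /= /omega => ->.
Qed.

HB.instance Definition _ n f := isMeasurableFun.Build _ _ _ _ (omega n f)
  (measurable_omega n f).

Definition universal (P : probability (boundary T) R) (w : T -> T -> F) :
    set (harmonic_functions w) :=
  [set f | dense (range (fun n =>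
     L0_class P (omega n (set_val f : T -> E) : {mfun _ >-> _})))].

End harmonic_functions.
Arguments harmonic_functions {R F} E {T} w.
Arguments universal {R F} E {T} P w.

(* Main.v *)
Require Import Defs.
From HB Require Import structures.
From mathcomp Require Import all_boot all_order all_algebra.
From mathcomp Require Import all_classical all_reals all_analysis.
From mathcomp Require Import borel_hierarchy lra.

(** A harmonic function may be prescribed freely at the root and at all but one
    child of every vertex: the value at the remaining child, the spare child,
    is then the unique solution of the mean value equation at the parent, since
    its coefficient is non-zero ([harmonic_extension]).  Every vertex has at
    least two children, so the spare child can be chosen with transition
    probability at most 1/2 ([ex_half_child]), and a random geodesic goes
    through spare children only during k consecutive steps with probability at
    most 2^-k ([prob_spare_run]).

    This lets one steer a harmonic function, with known values up to level m,
    towards any prescribed function phi on a later level n.  Extend phi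
    backwards from level n by iterating the weighted average over children,
    which gives a function satisfying the mean value equation between the
    levels m and n, and prescribe these values at the non-spare vertices.  As
    soon as a geodesic meets a non-spare vertex after level m, the harmonic
    function agrees with the backward extension there, hence at all its
    descendants down to level n, where it is equal to phi
    ([steered_harmonic]).  The exceptional geodesics have probability at most
    2^-(n - m).

    Every measurable function from the boundary to E is a limit in probability
    of functions that depend on one level only and take values in a countable
    dense subset of E ([target_dense]); these targets form a countable family.
    Thus f is universal iff for every target and every s some omega_n f is
    within 1/(s+1) of it ([universalP]).  Each of these countably many
    conditions is a union of open ones, because omega_n f involves finitely
    many coordinates of f, and so the universal functions form a G_delta.

    Density comes from one explicit construction, and not from a category
    argument, since H(T,E) need not be a Baire space when E is not complete:
    starting from a harmonic f0 and a level N, keep f0 up to level N and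
    then steer towards the targets one after the other, with as many steps as
    the required precision asks for.  The result is universal, and it converges
    to f0 pointwise as N grows ([dense_universal]). *)

Set Implicit Arguments.
Unset Strict Implicit.
Unset Printing Implicit Defensive.
Import Order.TTheory GRing.Theory Num.Theory.
Import numFieldNormedType.Exports.

Local Open Scope classical_set_scope.
Local Open Scope ring_scope.

(** * Levels, parents and geodesics *)

Section tree.
Context {T : rooted_tree}.
Implicit Types (x y : T) (e : boundary T).

Lemma level_inj m n x : level m x -> level n x -> m = n.
Proof. by move=> mx nx; apply: (@level_disjoint T) => //; exists x. Qed.

Lemma ex_level x : exists n, level n x.
Proof.
have [n _ nx] : (\bigcup_n level n) x by rewrite level_cover.
by exists n.
Qed.

Lemma child_level n x y : level n x -> child x y -> level n.+1 y.
Proof. by move=> nx xy; have [<- _ _] := child_partition T n; exists x. Qed.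

Lemma level_child n x y : level n.+1 y -> child x y -> level n x.
Proof.
move=> ny xy; have [m mx] := ex_level x.
by have /level_inj/(_ ny)[<-] := child_level mx xy.
Qed.

Lemma child_inj x x' y : child x y -> child x' y -> x = x'.
Proof.
move=> xy x'y; have [n nx] := ex_level x.
have nx' := level_child (child_level nx xy) x'y.
by have [_ tI _] := child_partition T n; apply: tI => //; exists y.
Qed.

Lemma child_finite x : finite_set (child x).
Proof.
have [n nx] := ex_level x; apply: sub_finite_set (level_finite T n.+1).
by move=> y; exact: child_level.
Qed.

Definition parent y : T := xget tree_root [set x | child x y].

Lemma parentE x y : child x y -> parent y = x.
Proof. by move=> xy; apply: xget_subset1 => // a b; exact: child_inj. Qed.

Lemma parent_child n y : level n.+1 y -> child (parent y) y.
Proof.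
have [<- _ _] := child_partition T n.
by case=> x _ xy; rewrite (parentE xy).
Qed.

Lemma geodesic_child e n : child (geodesic e n) (geodesic e n.+1).
Proof. by have [_] : geodesics (geodesic e) := set_valP e. Qed.

Lemma parent_geodesic e n : parent (geodesic e n.+1) = geodesic e n.
Proof. exact/parentE/geodesic_child. Qed.

Lemma iter_parent_geodesic e k n :
  iter k parent (geodesic e (n + k)) = geodesic e n.
Proof.
by elim: k => [|k IHk]; rewrite ?addn0// addnS iterSr parent_geodesic.
Qed.

Lemma geodesic_agree e e' m n : (m <= n)%N ->
  geodesic e n = geodesic e' n -> geodesic e m = geodesic e' m.
Proof.
by move=> /subnKC <- ee'; rewrite -(iter_parent_geodesic e (n - m)) ee'
  iter_parent_geodesic.
Qed.

(** Climb to the root through parents, and go down beyond y through arbitrary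
    children. *)
Lemma geodesic_through n y : level n y -> exists e, geodesic e n = y.
Proof.
have /boolp.choice[f cf] : forall x : T, exists y, child x y.
  by move=> x; have [z [_ [xz _ _]]] := child_ge2 x; exists z.
elim: n y => [|n IHn] y ny.
  have [e _] := boundary_nonempty T; exists e.
  have := geodesic_level e 0.
  by move: ny; rewrite !level0 /= => -> ->.
have py := parent_child ny.
have [e en] := IHn _ (level_child ny py).
pose z j := if (j <= n)%N then geodesic e j else iter (j - n.+1) f y.
have gz : geodesics z.
  split=> [|j]; rewrite /z.
    by have [] : geodesics (geodesic e) := set_valP e.
  case: (ltngtP j n) => [jn|nj|->].
  - exact: geodesic_child.
  - by rewrite subSn//= => //; exact: cf.
  - by rewrite en subnn.
exists (SigSub (mem_set gz)).
by change (z n.+1 = y); rewrite /z ltnn subnn.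
Qed.

Lemma cylinder_level n x e : level n x -> cylinder x e = (geodesic e n = x).
Proof. by move=> nx; rewrite (cylinderE nx). Qed.

(** The events that can be observed at level n: unions of cylinders of
    vertices of that level. *)
Definition saturated n (S : set (boundary T)) :=
  forall e e', geodesic e n = geodesic e' n -> S e -> S e'.

Definition trace n (S : set (boundary T)) : set T :=
  [set geodesic e n | e in S].

Lemma trace_level n S : trace n S `<=` level n.
Proof. by move=> _ [e _ <-]; exact: geodesic_level. Qed.

Lemma trace_finite n S : finite_set (trace n S).
Proof. exact: sub_finite_set (@trace_level n S) (level_finite T n). Qed.

Lemma saturatedE n S : saturated n S -> S = \bigcup_(x in trace n S) cylinder x.
Proof.
move=> satS; apply/seteqP; split => [e Se|e [_ [e' Se' <-]]].
  by exists (geodesic e n); [exists e|exists n].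
rewrite (cylinder_level e (geodesic_level e' n)) => ee'.
exact: satS (esym ee') Se'.
Qed.

Lemma saturated_measurable n S : saturated n S -> measurable S.
Proof.
move=> /saturatedE ->; apply: fin_bigcup_measurable (trace_finite n S) _ => x _.
exact: measurable_cylinder.
Qed.

Lemma saturatedW m n S : (m <= n)%N -> saturated m S -> saturated n S.
Proof. by move=> mn satS e e' /(geodesic_agree mn); exact: satS. Qed.

Lemma saturatedC n S : saturated n S -> saturated n (~` S).
Proof.
by move=> satS e e' ee' nSe Se'; apply: nSe; exact: satS (esym ee') Se'.
Qed.

End tree.

(** * Geodesics that keep to the spare children *)

Section spare.
Context {R : realType} {T : rooted_tree} {q : T -> T -> R}
  {P : probability (boundary T) R} {b : T -> T}.
Hypothesis P_cylinder : forall (n : nat) (y : nat -> T),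
  y 0%N = tree_root -> (forall j, (j < n)%N -> child (y j) (y j.+1)) ->
  P (cylinder (y n)) = (\prod_(0 <= j < n) q (y j) (y j.+1))%:E.
Hypothesis b_child : forall x, child x (b x).
Hypothesis b_half : forall x, q x (b x) <= 2^-1.

Lemma prob_cylinder_geodesic e n :
  P (cylinder (geodesic e n)) =
  (\prod_(0 <= j < n) q (geodesic e j) (geodesic e j.+1))%:E.
Proof.
have [e0 eS] : geodesics (geodesic e) := set_valP e.
by apply: P_cylinder => // j _; exact: geodesic_child.
Qed.

Lemma prob_cylinder_child x y : child x y ->
  P (cylinder y) = (P (cylinder x) * (q x y)%:E)%E.
Proof.
move=> xy; have [n nx] := ex_level x.
have [e ey] := geodesic_through (child_level nx xy).
have ex : geodesic e n = x by rewrite -parent_geodesic ey (parentE xy).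
by rewrite -ex -ey !prob_cylinder_geodesic big_nat_recr.
Qed.

(** S is a disjoint union of cylinders of vertices x of level n, and passing to
    the spare child b x multiplies the probability of each of them by
    q x (b x). *)
Lemma prob_spare n (S : set (boundary T)) : saturated n S ->
  (P (S `&` [set e | geodesic e n.+1 = b (geodesic e n)]) <=
   (2^-1)%:E * P S)%E.
Proof.
move=> satS.
have -> : S `&` [set e | geodesic e n.+1 = b (geodesic e n)] =
    \bigcup_(x in trace n S) cylinder (b x).
  apply/seteqP; split=> [e [Se eb]|e [_ [e' Se' <-]]].
    by exists (geodesic e n); [exists e|exists n.+1].
  have lb := child_level (geodesic_level e' n) (b_child (geodesic e' n)).
  rewrite (cylinder_level e lb) => eb.
  have ee' : geodesic e n = geodesic e' n.
    by rewrite -parent_geodesic eb (parentE (b_child _)).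
  by split; [exact: satS (esym ee') Se'|rewrite /= ee'].
rewrite [in leRHS](saturatedE satS) !measure_fin_bigcup//.
- rewrite ge0_mule_fsumr//; apply: lee_fsum => [|x _]; first exact: trace_finite.
  rewrite [leLHS](prob_cylinder_child (b_child x)) muleC.
  by rewrite lee_wpmul2r// lee_fin.
- exact: trace_finite.
- move=> x y tx ty [e []].
  rewrite (cylinder_level e (trace_level tx)) => <-.
  by rewrite (cylinder_level e (trace_level ty)) => <-.
- by move=> x _; exact: measurable_cylinder.
- exact: trace_finite.
- move=> x y tx ty [e []].
  rewrite (cylinder_level e (child_level (trace_level tx) (b_child x))) => ex.
  rewrite (cylinder_level e (child_level (trace_level ty) (b_child y))) => ey.
  by apply: child_inj (b_child x) _; rewrite -ex ey.
- by move=> x _; exact: measurable_cylinder.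
Qed.

Definition spare_run a k : set (boundary T) :=
  [set e | forall j, (j < k)%N ->
    geodesic e (a + j).+1 = b (geodesic e (a + j))].

Lemma spare_run_saturated a k : saturated (a + k) (spare_run a k).
Proof.
move=> e e' ee' run j jk; have jk' : (a + j < a + k)%N by rewrite ltn_add2l.
by rewrite -(geodesic_agree jk' ee') -(geodesic_agree (ltnW jk') ee') run.
Qed.

Lemma prob_spare_run a k : (P (spare_run a k) <= (2^-1 ^+ k)%:E)%E.
Proof.
elim: k => [|k IHk].
  exact: probability_le1 (saturated_measurable (@spare_run_saturated a 0)).
have -> : spare_run a k.+1 = spare_run a k `&`
    [set e | geodesic e (a + k).+1 = b (geodesic e (a + k))].
  apply/seteqP; split=> [e run|e [run ek] j].
    by split=> [j /ltnW jk|]; exact: run.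
  by rewrite ltnS leq_eqVlt => /predU1P[->//|]; exact: run.
apply: le_trans (prob_spare (@spare_run_saturated a k)) _.
by rewrite exprS EFinM lee_wpmul2l// lee_fin.
Qed.

End spare.
Arguments spare_run {T} b a k.

(** * Harmonic functions with prescribed values *)

Lemma ex_half_child (R : realType) (T : rooted_tree) (q : T -> T -> R) :
  (forall x y, 0 <= q x y) -> (forall x, \sum_(y \in child x) q x y = 1) ->
  exists b : T -> T, forall x, child x (b x) /\ q x (b x) <= 2^-1.
Proof.
move=> q0 q1.
suff /boolp.choice[b bP] : forall x, exists y, child x y /\ q x y <= 2^-1.
  by exists b.
move=> x.
have [y [z [xy xz yz]]] := child_ge2 x.
have := q1 x; have cx := child_finite x.
rewrite (fsbigD1 y)// (fsbigD1 z)//=; last 2 first.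
- exact: finite_setD.
- by split => // zy; exact: yz.
have : 0 <= \sum_(i \in (child x `\ y) `\ z) q x i by apply: fsumr_ge0.
have [qy|qy] := leP (q x y) 2^-1; first by exists y.
by move=> s0 s1; exists z; split => //; lra.
Qed.

Section harmonic.
Context {R : realType} {F : sepTopFieldType} {E : sepMetricTvs R F}
  {T : rooted_tree} {w : T -> T -> F} {b : T -> T}.
Hypothesis w_neq0 : forall x y : T, child x y -> w x y != 0.
Hypothesis b_child : forall x, child x (b x).
Implicit Types (f g : T -> E) (x y : T).

(** The right-hand side of the mean value equation at x. *)
Definition average f x : E := \sum_(y \in child x) w x y *: f y.

Lemma averageD1 f x :
  average f x =
  w x (b x) *: f (b x) + \sum_(y \in child x `\ b x) w x y *: f y.
Proof. by apply: fsbigD1 => //; exact: child_finite. Qed.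

(** The spare value is determined by the others, because w x (b x) is
    invertible. *)
Lemma average_inj f g x : average f x = average g x ->
  (forall y, child x y -> y != b x -> f y = g y) ->
  forall y, child x y -> f y = g y.
Proof.
move=> fgx fg y xy; have [->|] := eqVneq y (b x); last exact: fg.
move: fgx; rewrite !averageD1.
have -> : \sum_(z \in child x `\ b x) w x z *: f z =
          \sum_(z \in child x `\ b x) w x z *: g z.
  by apply: eq_fsbigr => z /[!inE]/= -[xz /eqP zb]; rewrite fg.
by move=> /addIr; exact: (scalerI (w_neq0 (b_child x))).
Qed.

Definition depth x : nat := xget 0%N [set n | level n x].

Lemma depthE n x : level n x -> depth x = n.
Proof. by move=> nx; apply: xget_subset1 => // a c; exact: level_inj. Qed.

(** The recursion along the path from the root to y: at a spare vertex the mean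
    value equation of the parent is solved for the value at y, the siblings
    having the prescribed values.  The fuel n is meant to be the level of y. *)
Fixpoint fill g n y : E :=
  if n is n'.+1 then
    if y == b (parent y) then
      (w (parent y) y)^-1 *: (fill g n' (parent y) -
        \sum_(z \in child (parent y) `\ y) w (parent y) z *: g z)
    else g y
  else g y.

(** The values at the root and at the non-spare vertices are free parameters of
    a harmonic function. *)
Lemma harmonic_extension g : exists f, [/\ harmonic_functions E w f,
  f tree_root = g tree_root &
  forall x y, child x y -> y != b x -> f y = g y].
Proof.
exists (fun y => fill g (depth y) y); split=> [x||x y xy yb].
- have [n nx] := ex_level x; rewrite (depthE nx).
  rewrite -/(average _ x) averageD1.
  have dx y : child x y -> depth y = n.+1 by move=> /(child_level nx)/depthE.
  rewrite (dx _ (b_child x)) /= (parentE (b_child x)) eqxx.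
  rewrite scalerA divff ?w_neq0// scale1r.
  rewrite [X in _ - _ + X](_ : _ = \sum_(z \in child x `\ b x) w x z *: g z).
    by rewrite subrK.
  apply: eq_fsbigr => z /[!inE]/= -[xz /eqP zb].
  by rewrite (dx _ xz) /= (parentE xz) (negbTE zb).
- by rewrite (@depthE 0)// level0.
- have [n nx] := ex_level x.
  by rewrite (depthE (child_level nx xy)) /= (parentE xy) (negbTE yb).
Qed.

(** Prescribed values for steering: f0 up to level n 0, and on the block of
    levels (n k, n (k+1)] the backward extension of phi k from level n (k+1).
    The blocks are disjoint, so these requirements are compatible. *)
Lemma ex_schedule (n : nat -> nat) (phi : nat -> T -> E) (f0 : T -> E) :
  (forall k, (n k <= n k.+1)%N) ->
  exists g : T -> E,
    (forall l x, level l x -> (l <= n 0)%N -> g x = f0 x) /\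
    (forall k l x, level l x -> (n k < l <= n k.+1)%N ->
       g x = iter (n k.+1 - l) average (phi k) x).
Proof.
move=> nS.
have n_mono := @homo_leq _ n leq leqnn (fun _ _ _ => @leq_trans _ _ _) nS.
suff /boolp.choice[g gP] : forall x, exists v : E,
    (forall l, level l x -> (l <= n 0)%N -> v = f0 x) /\
    (forall k l, level l x -> (n k < l <= n k.+1)%N ->
       v = iter (n k.+1 - l) average (phi k) x).
  exists g; split=> [l x|k l x]; first exact: (gP x).1.
  exact: (gP x).2.
move=> x; have [l lx] := ex_level x.
have [l0|l0] := leqP l (n 0%N).
  exists (f0 x); split=> // k m mx; rewrite (level_inj mx lx) => /andP[nkl _].
  by have := leq_trans nkl l0; rewrite ltnNge n_mono.
have [[k kl]|nk] := pselect (exists k, (n k < l <= n k.+1)%N); last first.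
  exists 0; split=> [m mx|k m mx]; rewrite (level_inj mx lx).
    by rewrite leqNgt l0.
  by move=> kl; case: nk; exists k.
exists (iter (n k.+1 - l) average (phi k) x).
split=> [m mx|k' m mx]; rewrite (level_inj mx lx); first by rewrite leqNgt l0.
move=> kl'; suff -> : k = k' by [].
move: kl kl' => /andP[kl lk] /andP[kl' lk'].
apply/eqP; rewrite eqn_leq; apply/andP; split; rewrite leqNgt; apply/negP.
  by move=> /n_mono k'k; have := leq_trans (leq_trans kl lk') k'k; rewrite ltnn.
by move=> /n_mono k'k; have := leq_trans (leq_trans kl' lk) k'k; rewrite ltnn.
Qed.

(** Within a block, agreement of f with the prescribed g at one vertex of a
    geodesic propagates to its children, since f and g both satisfy the mean
    value equation there and agree at the non-spare children.  On a geodesic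
    that visits a non-spare vertex in the block this yields f = g = phi k at the
    end of the block. *)
Lemma steered_harmonic (n : nat -> nat) (phi : nat -> T -> E) (f0 : T -> E) :
  (forall k, (n k <= n k.+1)%N) -> harmonic_functions E w f0 ->
  exists f, [/\ harmonic_functions E w f,
    forall l x, level l x -> (l <= n 0)%N -> f x = f0 x &
    forall k (e : boundary T), ~ spare_run b (n k) (n k.+1 - n k) e ->
      f (geodesic e (n k.+1)) = phi k (geodesic e (n k.+1))].
Proof.
move=> nS f0H; have [g [g0 gk]] := ex_schedule phi f0 nS.
have [f [fH froot fg]] := harmonic_extension g; exists f; split => //.
  elim=> [x|l IHl y ly ln].
    rewrite level0 => /= -> _; rewrite froot; apply: (g0 0%N) => //.
    by rewrite level0.
  have py := parent_child ly; have lx := level_child ly py.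
  apply: (@average_inj f f0 (parent y)) => //.
    by rewrite /average -fH -f0H; apply: IHl => //; exact: ltnW.
  move=> z xz zb; rewrite (fg _ _ xz zb).
  exact: g0 (child_level lx xz) ln.
move=> k e; set N := n k.+1.
move=> /existsNP[j /not_implyP[jk /eqP jb]].
have jN : ((n k + j).+1 <= N)%N by rewrite -addnS -leq_subRL ?nS.
suff fgN i : ((n k + j).+1 + i <= N)%N ->
    f (geodesic e ((n k + j).+1 + i)) = g (geodesic e ((n k + j).+1 + i)).
  have := fgN (N - (n k + j).+1)%N; rewrite subnKC// => ->//.
  rewrite (gk k N _ (geodesic_level e N)) ?subnn//.
  by rewrite leqnn andbT (leq_trans _ jN)// ltnS leq_addr.
elim: i => [|i IHi] iN.
  by rewrite addn0; apply: fg jb; exact: geodesic_child.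
move: iN; rewrite addnS; set l := (_.+1 + i)%N => lN.
have kl : (n k < l)%N by rewrite /l addSn ltnS -addnA leq_addr.
apply: (@average_inj f g (geodesic e l)); last exact: geodesic_child; last first.
  by move=> y; exact: fg.
rewrite {1}/average -fH IHi ?(ltnW lN)//.
rewrite (gk k l _ (geodesic_level e l)) ?kl ?(ltnW lN)//.
rewrite -/N -(subnSK lN) iterS; apply: eq_fsbigr => y /[!inE] ly.
rewrite (gk k l.+1)//; first exact: child_level (geodesic_level e l) ly.
by rewrite lN ltnS ltnW.
Qed.

End harmonic.
Arguments average {R F E T} w f x.

(** * Convergence in probability *)

Section convergence_in_probability.
Context {d : measure_display} {X : measurableType d} {R : realType}
  {F : sepTopFieldType} {P : probability X R} {E : sepMetricTvs R F}.
Implicit Types h g : {mfun X >-> borel E}.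

Lemma bdist_le_mdist (x y : E) : bdist x y <= mdist x y.
Proof.
rewrite ler_pdivrMr ?ltr_pwDl ?mdist_ge0// ler_peMr ?mdist_ge0//.
by rewrite lerDl mdist_ge0.
Qed.

Lemma mdist_L0 h g : mdist (L0_class P h) (L0_class P g) = prob_dist P h g.
Proof. exact: L0_dist_class. Qed.

Lemma prob_dist_sym h g : prob_dist P h g = prob_dist P g h.
Proof. by rewrite -!mdist_L0 metric_sym. Qed.

Lemma prob_dist_triangle g h (k : {mfun X >-> borel E}) :
  prob_dist P h k <= prob_dist P h g + prob_dist P g k.
Proof. by rewrite -!mdist_L0 metric_triangle. Qed.

Lemma L0_classP (u : L0 P E) : exists h, u = L0_class P h.
Proof. by exists (repr u); rewrite /L0_class reprK. Qed.

(** [bdist h g] is at most r outside B and at most 1 on B. *)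
Lemma prob_dist_le h g (B : set X) (r s : R) : measurable B ->
  0 <= r -> (P B <= s%:E)%E -> (forall x, ~ B x -> bdist (h x : E) (g x) <= r) ->
  prob_dist P h g <= r + s.
Proof.
move=> mB r0 Bs hg.
have ibd : P.-integrable setT (EFin \o (fun x => bdist (h x : E) (g x : E))).
  apply: measurable_bounded_integrable => //.
  - exact: le_lt_trans (probability_le1 P measurableT) (ltry _).
  - exact: measurable_bdist.
  - exists 1; split => // M M1 x _ /=.
    by rewrite ger0_norm ?bdist_ge0// (le_trans (bdist_le1 _ _))// ltW.
have ic : P.-integrable setT (EFin \o cst r).
  exact: finite_measure_integrable_cst.
have iB : P.-integrable setT (EFin \o (\1_B : X -> R)).
  exact: integrable_indic.
apply: (@le_trans _ _ (\int[P]_x (r + (\1_B : X -> R) x))).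
  apply: le_Rintegral => //; first exact: (integrableD measurableT ic iB).
  move=> x _; have [Bx|nBx] := pselect (B x).
    by rewrite indicE mem_set// (le_trans (bdist_le1 _ _))// lerDr.
  by rewrite indicE memNset// addr0 hg.
rewrite RintegralD// lerD//.
  rewrite /Rintegral integral_cst//.
  by rewrite [X in (_ * X)%E]probability_setT mule1.
rewrite /Rintegral integral_indic// setIT.
by rewrite -lee_fin fineK// fin_num_measure.
Qed.

Lemma small_remainder (A : nat -> set X) (r : R) : 0 < r ->
  (forall k, measurable (A k)) ->
  exists n, (P (\bigcup_k A k `\` \bigcup_(k < n) A k) < r%:E)%E.
Proof.
move=> r0 mA; pose G n := \bigcup_k A k `\` \bigcup_(k < n) A k.
have mG n : measurable (G n).
  by apply: measurableD; [exact: bigcup_measurable|exact: bigcup_measurable].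
have G0 : \bigcap_n G n = set0.
  apply/seteqP; split => // x Gx.
  by have [[k _ Akx] _] := Gx 0%N I; have [_] := Gx k.+1 I; apply; exists k => /=.
have GP : (P \o G) n @[n --> \oo] --> (0 : \bar R)%E.
  rewrite -(measure0 P) -G0; apply: nonincreasing_cvg_mu => //.
  - exact: le_lt_trans (probability_le1 P (mG 0%N)) (ltry _).
  - by rewrite G0.
  - move=> m n mn; apply/subsetPset => x [Ax nAx]; split => // -[k /= km Akx].
    apply: nAx.
    by exists k => //=; exact: leq_trans mn.
have : \forall n \near \oo, (P (G n) < r%:E)%E.
  apply: (GP [set y : \bar R | (y < r%:E)%E]).
  by apply: open_nbhs_nbhs; split; [exact: open_ereal_lt_ereal|rewrite /= lte_fin].
by move=> [n _ /(_ n (leqnn n))]; exists n.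
Qed.

End convergence_in_probability.

(** * A countable dense family of functions of one level *)

Section approximation.
Context {R : realType} {T : rooted_tree} {P : probability (boundary T) R}.
Implicit Types A S B : set (boundary T).

(** Up to events of arbitrarily small probability, A can be observed at some
    finite level. *)
Definition approximable A := forall r : R, 0 < r -> exists m S B,
  [/\ saturated m S, measurable B, (P B <= r%:E)%E &
      forall e, ~ B e -> (A e <-> S e)].

(** Finitely many events can be observed at a common level, outside a common
    exceptional event. *)
Lemma approximable_finite (A : nat -> set (boundary T)) n (r : R) : 0 < r ->
  (forall k, approximable (A k)) ->
  exists m (S : nat -> set (boundary T)) B, [/\ forall k, saturated m (S k),
    measurable B, (P B <= r%:E)%E &
    forall e k, (k < n)%N -> ~ B e -> (A k e <-> S k e)].
Proof.
move=> r0 apA; elim: n r r0 => [|n IHn] r r0.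
  exists 0%N, (fun=> set0), set0; split=> [k e e' _||| ]//.
  by rewrite [leLHS]measure0 lee_fin ltW.
have r20 : 0 < r / 2 by rewrite divr_gt0.
have [m [S [B [satS mB PB AS]]]] := IHn _ r20.
have [m' [S' [B' [satS' mB' PB' AS']]]] := apA n _ r20.
exists (maxn m m'), (fun k => if k == n then S' else S k), (B `|` B').
split=> [k||//|e k].
- case: ifP => _; first exact: saturatedW (leq_maxr _ _) satS'.
  exact: saturatedW (leq_maxl _ _) (satS k).
- exact: measurableU.
- rewrite (le_trans (measureU2 _ mB mB'))// [r in leRHS]splitr EFinD.
  exact: leeD.
- rewrite ltnS leq_eqVlt => /predU1P[->|kn] nB.
    by rewrite eqxx; apply: AS' => B'e; apply: nB; right.
  by rewrite ltn_eqF//; apply: AS => // Be; apply: nB; left.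
Qed.

(** The approximable measurable events form a sigma-algebra that contains the
    cylinders; a countable union is first replaced by a finite one. *)
Lemma measurable_approximable A : measurable A -> approximable A.
Proof.
suff : <<s boundary_gen (T:=T) >> `<=`
    [set A : set (boundary T) | measurable A /\ approximable A].
  by move=> + mA => /(_ A mA) [].
clear A; have sigma : sigma_algebra setT
    [set A : set (boundary T) | measurable A /\ approximable A].
  split=> /=.
  - split => // r r0; exists 0%N, set0, set0; split=> [e e' _||| ]//.
    by rewrite [leLHS]measure0 lee_fin ltW.
  - move=> A [mA apA]; rewrite setTD; split; first exact: measurableC.
    move=> r /apA[m [S [B [satS mB PB AS]]]]; exists m, (~` S), B.
    split=> [||//|e /AS]//; first exact: saturatedC.
    by move=> AS'; split=> nA Ae; apply: nA; exact/AS'.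
  - move=> A mapA; have [mA apA] := all_and2 mapA.
    split; first exact: bigcup_measurable.
    move=> r r0; have r20 : 0 < r / 2 by rewrite divr_gt0.
    have [n Dn] := small_remainder (P := P) r20 mA.
    have [m [S [B [satS mB PB AS]]]] := approximable_finite n r20 apA.
    have mD : measurable (\bigcup_k A k `\` \bigcup_(k < n) A k).
      by apply: measurableD; exact: bigcup_measurable.
    exists m, (\bigcup_(k < n) S k),
      ((\bigcup_k A k `\` \bigcup_(k < n) A k) `|` B); split.
    + by move=> e e' ee' [k kn Sk]; exists k => //; exact: satS ee' Sk.
    + exact: measurableU.
    + rewrite (le_trans (measureU2 _ mD mB))// [r in leRHS]splitr EFinD.
      by apply: leeD => //; exact: ltW.
    + move=> e /not_orP[nD nB]; split=> [Ae|[k kn /(AS e k kn nB)]]; last by exists k.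
      have [k kn Ake] : (\bigcup_(k < n) A k) e.
        by apply: contrapT => nA; apply: nD; split.
      by exists k => //; exact/(AS e k kn nB).
apply: smallest_sub => //.
move=> A [n _]; apply: smallest_sub => // _ [x nx <-].
split; first exact: measurable_cylinder.
move=> r r0; exists n, (cylinder x), set0; split => //.
- by rewrite (cylinderE nx) => e e' /= ->.
- by rewrite [leLHS]measure0 lee_fin ltW.
Qed.

End approximation.

Section targets.
Context {R : realType} {F : sepTopFieldType} {E : sepMetricTvs R F}
  {T : rooted_tree} (P : probability (boundary T) R) (D : nat -> E).
Hypothesis D_dense : dense (range D).

(** The code c consists of a level and of a list of indices into D, read along an
    enumeration of that level; thus the targets are a countable family that
    contains every D-valued function on a level. *)
Definition target (c : nat * seq nat) (x : T) : E :=
  D (nth 0%N c.2 (index x (finmap.enum_fset (fset_set (level c.1))))).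

Lemma target_code n (k : T -> nat) : exists s : seq nat,
  forall x, level n x -> target (n, s) x = D (k x).
Proof.
set v : seq T := finmap.enum_fset (fset_set (level n)).
exists (map k v) => x nx.
have xv : x \in v by rewrite /v in_fset_set ?inE//; exact: level_finite.
by rewrite /target /= -/v (nth_map x) ?index_mem// nth_index.
Qed.

(** Finitely many balls around points of D contain the values of h with
    probability close to 1.  Replace the preimages of these balls by events
    observed at a common level m, and send a vertex of level m to the centre of
    the first ball whose event it belongs to. *)
Lemma target_dense (h : {mfun boundary T >-> borel E}) (r : R) : 0 < r ->
  exists c, prob_dist P h (omega c.1 (target c)) < r.
Proof.
move=> r0; have r40 : 0 < r / 4 by rewrite divr_gt0.
pose A k := [set e | mdist (D k) (h e : E) < r / 4].
have mA k : measurable (A k).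
  have /borel_measurable_funP mh := measurable_funPT h.
  exact: (mh _ (@open_mball _ _ _ (D k) (r / 4))).
have [n Dn] := small_remainder (P := P) r40 mA.
have [m [S [B [satS mB PB AS]]]] :=
  approximable_finite n r40 (fun k => measurable_approximable (P := P) (mA k)).
(* The index of the first event that contains the cylinder of x; it is n when
   there is none. *)
pose kappa (x : T) := find (fun k => `[< trace m (S k) x >]) (iota 0 n).
have [s sP] := target_code m kappa.
exists (m, s).
have mD : measurable (\bigcup_k A k `\` \bigcup_(k < n) A k).
  by apply: measurableD; exact: bigcup_measurable.
apply: (@le_lt_trans _ _ (r / 4 + (r / 4 + r / 4))); last by lra.
apply: (@prob_dist_le _ _ _ _ _ _ _ _
    ((\bigcup_k A k `\` \bigcup_(k < n) A k) `|` B)).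
- exact: measurableU.
- exact: ltW.
- rewrite (le_trans (measureU2 _ mD mB))// EFinD.
  by apply: leeD => //; exact: ltW.
move=> e /not_orP[nD nB].
have [k kn Ake] : (\bigcup_(k < n) A k) e.
  apply: contrapT => nA; apply: nD; split => //.
  have [y [/= hd [k _ ky]]] :
      [set y : E | mdist (h e : E) y < r / 4] `&` range D !=set0.
    by apply: D_dense; [exists (h e : E); rewrite /= mdistxx|exact: open_mball].
  by exists k => //; rewrite /A /= ky metric_sym.
have has_k : has (fun k => `[< trace m (S k) (geodesic e m) >]) (iota 0 n).
  apply/hasP; exists k; first by rewrite mem_iota.
  by apply/asboolP; exists e => //; apply/(AS e k kn nB).
have kappa_n : (kappa (geodesic e m) < n)%N.
  by move: has_k; rewrite has_find size_iota.
have := nth_find 0%N has_k; rewrite -/(kappa _) nth_iota// add0n.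
move=> /asboolP[e' Se' /satS/(_ Se')/(AS e _ kappa_n nB)] Ae.
rewrite /= /omega sP; last exact: geodesic_level.
by rewrite (le_trans (bdist_le_mdist _ _))// metric_sym ltW.
Qed.

End targets.

(** * Universal harmonic functions *)

Lemma dense_mdistP (R : realType) (M : metricType R) (S : set M) :
  dense S <-> forall x (r : R), 0 < r -> exists2 y, S y & mdist x y < r.
Proof.
split=> [dS x r r0|SP O [x Ox] oO].
  have [y [yr Sy]] : (ball x r)° `&` S !=set0.
    by apply: dS; [exists x; exact: nbhsx_ballx|exact: open_interior].
  by exists y => //; have := interior_subset yr; rewrite ballEmdist.
have /nbhs_ballP[r /= r0 rO] : nbhs x O by exact: open_nbhs_nbhs.
have [y Sy xy] := SP x r r0.
by exists y; split => //; apply: rO; rewrite ballEmdist.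
Qed.

Lemma separable_sequence (X : topologicalType) (x0 : X) :
  separable X -> exists u : nat -> X, dense (range u).
Proof.
move=> [D cD dD]; have [D0|[f]] := pfcard_geP cD.
  have [y [_]] : setT `&` D !=set0 by apply: dD; [exists x0|exact: openT].
  by rewrite D0.
by exists f; rewrite image_eq.
Qed.

Lemma surjective_code (C : countType) (c0 : C) :
  exists code : nat -> C, forall c, exists k, code k = c.
Proof.
exists (fun k => odflt c0 (unpickle k)) => c; exists (pickle c).
by rewrite pickleK.
Qed.

Lemma ptws_eventually (T : choiceType) (X : topologicalType)
    (f : nat -> T -> X) (f0 : T -> X) :
  (forall x, \forall N \near \oo, f N x = f0 x) ->
  f N @[N --> \oo] --> (f0 : {ptws T -> X}).
Proof.
move=> ff0.
apply/cvg_sup => x U [V [[W oW <-] Wf0 WU]].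
apply: filterS (ff0 x) => N fN; apply: WU => /=; by rewrite /= /proj fN.
Qed.

Section universality.
Context {R : realType} {F : sepTopFieldType} {E : sepMetricTvs R F}
  {T : rooted_tree} {P : probability (boundary T) R} {w : T -> T -> F}
  {D : nat -> E}.
Hypothesis D_dense : dense (range D).

Lemma universalP (f : harmonic_functions E w) : universal E P w f <->
  forall c s, exists n,
    prob_dist P (omega n (set_val f : T -> E)) (omega c.1 (target D c)) <
    s.+1%:R^-1.
Proof.
rewrite /universal /= dense_mdistP; split=> [fU c s|fU u r r0].
  have s0 : (0 : R) < s.+1%:R^-1 by rewrite invr_gt0.
  have [_ [n _ <-] fn] := fU (L0_class P (omega c.1 (target D c))) _ s0.
  by exists n; rewrite prob_dist_sym -mdist_L0.
have r20 : 0 < r / 2 by rewrite divr_gt0.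
have [h uh] := L0_classP u.
have [c hc] := target_dense P D_dense h r20.
have [s _ sr] := near_infty_natSinv_lt (PosNum r20).
have [n fc] := fU c s.
exists (L0_class P (omega n (set_val f : T -> E))); first by exists n.
rewrite uh mdist_L0.
rewrite (le_lt_trans (prob_dist_triangle (omega c.1 (target D c)) _ _))//.
rewrite [ltRHS]splitr ltrD// prob_dist_sym (lt_trans fc)//.
exact: (sr s (leqnn s)).
Qed.

(** [omega n f] only depends on the values of f at the finitely many vertices of
    level n, and moving these by less than t/2 moves it by at most t/2 in
    probability. *)
Lemma open_prob_dist_omega n (h : {mfun boundary T >-> borel E}) (r : R) :
  open [set f : harmonic_functions E w |
    prob_dist P (omega n (set_val f : T -> E)) h < r].
Proof.
rewrite openE => f /= fr.
set t := r - prob_dist P (omega n (set_val f : T -> E)) h.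
have t0 : 0 < t by rewrite subr_gt0.
have t20 : 0 < t / 2 by rewrite divr_gt0.
have nf x : nbhs f [set g : harmonic_functions E w |
    mdist ((set_val f : T -> E) x) ((set_val g : T -> E) x) < t / 2].
  have cv : continuous (set_val : harmonic_functions E w -> {ptws T -> E}).
    exact: initial_continuous.
  have cf : {for f, continuous (@proj T (fun=> E) x \o
      (set_val : harmonic_functions E w -> {ptws T -> E}))}.
    by apply: continuous_comp; [exact: cv|exact: proj_continuous].
  apply: (cf [set y | mdist ((set_val f : T -> E) x) y < t / 2]).
  apply: open_nbhs_nbhs; split; first exact: open_mball.
  by rewrite /= mdistxx.
have : nbhs f (\bigcap_(x in level n) [set g : harmonic_functions E w |
    mdist ((set_val f : T -> E) x) ((set_val g : T -> E) x) < t / 2]).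
  by rewrite -(fset_setK (level_finite T n)); apply: filter_bigI => x _.
apply: filterS => g /= fg.
rewrite (le_lt_trans (prob_dist_triangle (omega n (set_val f : T -> E)) _ _))//.
apply: (@le_lt_trans _ _ ((t / 2 + 0) +
    prob_dist P (omega n (set_val f : T -> E)) h)).
  rewrite lerD2r; apply: (@prob_dist_le _ _ _ _ _ _ _ _ set0).
  - by [].
  - exact: ltW.
  - by rewrite [leLHS]measure0.
  - move=> e _; rewrite (le_trans (bdist_le_mdist _ _))// metric_sym ltW//.
    by apply: fg; exact: geodesic_level.
by rewrite /t in t0 *; lra.
Qed.

Lemma Gdelta_universal : Gdelta (universal E P w).
Proof.
have [code codeP] := surjective_code (((0, [::]), 0) : (nat * seq nat) * nat)%N.
exists (fun k => \bigcup_n [set f : harmonic_functions E w |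
    prob_dist P (omega n (set_val f : T -> E))
      (omega (code k).1.1 (target D (code k).1)) < (code k).2.+1%:R^-1]).
  by move=> k; apply: bigcup_open => n _; exact: open_prob_dist_omega.
apply/seteqP; split=> [f /universalP fU k _|f fU].
  by have [n fn] := fU (code k).1 (code k).2; exists n.
apply/universalP => c s; have [k kE] := codeP (c, s).
by have [n _] := fU k I; rewrite /= kE; exists n.
Qed.

(** Every pair of a target and a precision is dealt with in one block, after
    level N, and f N is equal to f0 up to level N. *)
Lemma dense_universal (b : T -> T) :
  (forall x y : T, child x y -> w x y != 0) -> (forall x, child x (b x)) ->
  (forall a k, (P (spare_run b a k) <= (2^-1 ^+ k)%:E)%E) ->
  dense (universal E P w).
Proof.
move=> w_neq0 b_child b_run O [f0 Of0] [W oW WO].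
have [code codeP] := surjective_code (((0, [::]), 0) : (nat * seq nat) * nat)%N.
(* Block k is as long as needed for target (code k).1 to live on a level before
   its end, and for 2^-(len k) to be less than 1/(s+1), where s = (code k).2. *)
pose len k := ((code k).1.1 + (code k).2).+1.
pose n N := fix n k := if k is k'.+1 then (n k' + len k')%N else N.
pose phi N k (x : T) :=
  target D (code k).1 (iter (n N k.+1 - (code k).1.1) parent x).
have f0H : harmonic_functions E w (set_val f0) := set_valP f0.
have nS N k : (n N k <= n N k.+1)%N by rewrite leq_addr.
have /boolp.choice[f fP] N :=
  steered_harmonic w_neq0 b_child (phi N) (nS N) f0H.
have fW : \forall N \near \oo, W (f N).
  have : f N @[N --> \oo] --> (set_val f0 : {ptws T -> E}).
    apply: ptws_eventually => x; have [l lx] := ex_level x.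
    exists l => // N /= lN; have [_ fN _] := fP N.
    exact: fN lx lN.
  apply; apply: open_nbhs_nbhs; split => //.
  by move: Of0; rewrite -WO.
have [N _ /(_ N (leqnn N)) WfN] := fW.
have [fH _ fphi] := fP N.
exists (SigSub (mem_set fH)); split; first by rewrite -WO.
apply/universalP => c s; have [k kE] := codeP (c, s).
exists (n N k.+1).
have c1n : (c.1 <= n N k.+1)%N.
  by rewrite /= /len kE /= addnS -addSn addnCA leq_addr.
apply: (@le_lt_trans _ _ (0 + 2^-1 ^+ len k)).
  apply: (@prob_dist_le _ _ _ _ _ _ _ _ (spare_run b (n N k) (len k))) => //.
    exact: saturated_measurable (@spare_run_saturated _ b (n N k) (len k)).
  move=> e ne.
  have fe : f N (geodesic e (n N k.+1)) = target D c (geodesic e c.1).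
    rewrite fphi; last by rewrite /= addKn.
    rewrite /phi kE; congr (target D c _).
    by rewrite -[RHS](iter_parent_geodesic e (n N k.+1 - c.1)) subnKC.
  change (bdist (f N (geodesic e (n N k.+1))) (target D c (geodesic e c.1)) <= 0).
  by rewrite fe bdistxx.
rewrite add0r exprVn ltf_pV2 ?posrE ?exprn_gt0// -natrX ltr_nat.
apply: (@leq_trans (2 ^ s.+1)%N); first exact: ltn_expl.
by rewrite leq_exp2l// /len kE ltnS leq_addl.
Qed.

End universality.

Theorem theorem1 (R : realType) (F : sepTopFieldType) (E : sepMetricTvs R F)
    (T : rooted_tree)
    (w : T -> T -> F)
    (w_neq0 : forall x y : T, child x y -> w x y != 0)
    (q : T -> T -> R)
    (q_ge0 : forall x y : T, 0 <= q x y)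
    (q_gt0 : forall x y : T, 0 < q x y <-> child x y)
    (q_sum1 : forall x : T, \sum_(y \in child x) q x y = 1)
    (P : probability (boundary T) R)
    (P_cylinder : forall (n : nat) (y : nat -> T),
      y 0%N = tree_root -> (forall j, (j < n)%N -> child (y j) (y j.+1)) ->
      P (cylinder (y n)) = (\prod_(0 <= j < n) q (y j) (y j.+1))%:E) :
  dense (universal E P w) /\ Gdelta (universal E P w).
Proof.
have [D D_dense] := separable_sequence (0 : E) (tvs_separable E).
have [b /all_and2[b_child b_half]] := ex_half_child q_ge0 q_sum1.
split; last exact: Gdelta_universal D_dense.
apply: (dense_universal D_dense w_neq0 b_child) => a k.
exact: prob_spare_run P_cylinder b_child b_half a k.
Qed.
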